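(* Let $G$ be a locally compact group of Ulam-measurable local weight. Then: (1) $G$ admits a strictly finer group topology which agrees with the original one on every subset of $G$ of non-Ulam-measurable cardinality; (2) there exist a locally compact group $H$ and a sequentially continuous homomorphism $G\to H$ which is not continuous.
   Context: Topological groups are assumed Hausdorff. The weight $w(X)$ of a space $X$ is the least cardinality of a base for $X$. The local weight of a topological group $G$ is $\min\{w(U):U\text{ is a neighbourhood of the neutral element of }G\}$. An ultrafilter is $\omega_1$-complete if it is closed under intersections of countable families. A cardinal $\mathrm{Card}(A)$ is Ulam-measurable if there exists an $\omega_1$-complete free (nonprincipal) ultrafilter on $A$. Two topologies agree on a subset if they induce the same subspace topology on it. *)

(* Defs.v *)
From HB Require Import structures.
From mathcomp Require Import all_boot all_order all_algebra.
From mathcomp Require Import all_classical all_reals all_analysis.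

Set Implicit Arguments.
Unset Strict Implicit.
Unset Printing Implicit Defensive.

Local Open Scope classical_set_scope.
Local Open Scope card_scope.
Local Open Scope group_scope.

(* Several topologies are considered on one set, so a topology on [T] is taken
   to be an inhabitant [tau] of the class [Topological T], and
   [Topological.Pack tau] is [T] equipped with [tau]. *)

Definition group_topology (G : groupType) (tau : Topological G) : Prop :=
  let T := Topological.Pack tau in
  [/\ hausdorff_space T,
      continuous (fun z : T * T => (z.1 : G) * (z.2 : G) : T) &
      continuous (fun x : T => (x : G)^-1 : T)].

HB.mixin Record isTopologicalGroup G & Topological G & monoid.Group G := {
  group_topology_subproof : @group_topology G (Topological.class G)
}.

#[short(type="topologicalGroupType")]
HB.structure Definition TopologicalGroup :=
  {G of Topological G & monoid.Group G & isTopologicalGroup G}.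

Definition strictly_finer (T : Type) (tau1 tau2 : Topological T) : Prop :=
  @open (Topological.Pack tau2) `<` @open (Topological.Pack tau1).

(* Equality of the subspace topologies on the subtype [S]; the library's
   [subspace S] would instead retain all points of [T]. *)
Definition agree_on (T : Type) (S : set T) (tau1 tau2 : Topological T) : Prop :=
  @open (set_type (S : set (Topological.Pack tau1))) =
  @open (set_type (S : set (Topological.Pack tau2))).

Definition omega1_complete (T : Type) (F : set_system T) : Prop :=
  forall B : nat -> set T, (forall n, F (B n)) -> F (\bigcap_n B n).

Definition Ulam_measurable (T : Type) (A : set T) : Prop :=
  exists F : set_system (set_type A),
    [/\ UltraFilter F, omega1_complete F & forall x, F <> principal_filter x].

(* A cardinal is represented by any set [K] of that cardinality. *)
Definition is_weight (X : topologicalType) (T : Type) (K : set T) : Prop :=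
  (exists2 B : set (set X), basis B & K #= B) /\
  (forall B : set (set X), basis B -> K #<= B).

Definition is_local_weight (G : topologicalGroupType) (T : Type) (K : set T) :
    Prop :=
  (exists2 U : set G, nbhs (1 : G) U & is_weight (set_type U) K) /\
  (forall U : set G, nbhs (1 : G) U ->
     forall L : set (set (set_type U)), is_weight (set_type U) L -> K #<= L).

Definition sequentially_continuous (X Y : topologicalType) (f : X -> Y) : Prop :=
  forall (u : nat -> X) (x : X), u @ \oo --> x -> (f \o u) @ \oo --> f x.

(* Main.v *)
Require Import Defs.
From HB Require Import structures.
From mathcomp Require Import all_boot all_order all_algebra.
From mathcomp Require Import all_classical all_reals all_analysis.
From mathcomp Require wochoice.

(** Let [F] be a countably complete free ultrafilter on a set [T].  For a family
    [W] of neighbourhoods of [1] in [G], indexed by [T], call limit of [W] the set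
    of all [x] that lie in [W i] for almost every [i].  The limits form a base of
    neighbourhoods of [1] for a finer group topology ([group_filter_ultra_nbhs]),
    namely the one induced by the diagonal embedding of [G] in its ultrapower.
    This topology, for suitable [T] and [F], proves both parts.

    Agreement on small sets.  The powerset of a non-measurable set [S] is
    non-measurable ([Ulam_type_powerset]), so the trace of [W i] on [S] is the
    same for almost every [i]; on [S], the limit of [W] is thus a single [W i]
    ([ultra_nbhs_trace]).

    The locally compact group.  Cover a compact neighbourhood by finitely many
    translates of each [W i].  The number of translates is the same for almost
    every [i], and so is the rank of one that contains a given point.  Hence compact
    neighbourhoods remain totally bounded in the finer topology
    ([totally_bounded_ultra_nbhs]).  Its completion [H] is therefore locally
    compact ([locally_compact_completion]).  Convergent sequences are countable,
    so [G -> H] is sequentially continuous ([ultra_nbhs_sequence]); it is not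
    continuous if the finer topology is strictly finer.

    Strictness.  Well-order the sequences [s] of neighbourhoods, contained in a
    compact neighbourhood [V0], that satisfy [(s (n+1))^-1 * s (n+1) <= s n].
    Their intersections, here called cores, are compact subgroups.  Let [T] be the
    set of those [s] whose core does not contain the intersection [Q s] of all
    earlier cores, and pick [z s] in [Q s] outside some member of [s].  The cores
    of the members of [T] still intersect in the trivial group, so [V0] injects
    into the powerset of [T * nat * nat].  As every neighbourhood has measurable
    cardinality ([Ulam_type_nbhs]), so has [T], and this provides [F].
    If the limit of a suitable family contained a neighbourhood [V], then by
    compactness some [Q i0] would be contained in [C * V], where [C] is the
    intersection of almost all cores, hence in the limit of slightly larger
    neighbourhoods.  But products of some of the [z i], each correcting the
    position with respect to one [i] and not affecting the previous ones, yield,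
    again by compactness, a point of [Q i0] that avoids the [i]-th neighbourhood
    for almost every [i] ([limit_not_nbhs]). *)

Set Implicit Arguments.
Unset Strict Implicit.
Unset Printing Implicit Defensive.

Local Open Scope classical_set_scope.

(** * Countably complete ultrafilters *)

Lemma ultra_complement {T : Type} {F : set_system T} :
  UltraFilter F -> forall A : set T, F (~` A) <-> ~ F A.
Proof.
move=> UF A; split=> [FnA FA|nFA].
  by apply: (filter_not_empty F); rewrite -(setICr A); exact: filterI.
by have [] := in_ultra_setVsetC A UF.
Qed.

Lemma ultra_decides {T : Type} {F : set_system T} :
  ProperFilter F -> (forall A, F A \/ F (~` A)) -> UltraFilter F.
Proof.
move=> PF dec; split=> // G PG FG; apply/seteqP; split=> // A GA.
have [//|/FG GnA] := dec A.
by exfalso; apply: (filter_not_empty G); rewrite -(setICr A); exact: filterI.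
Qed.

Lemma ultra_fmap {T U : Type} (f : T -> U) {F : set_system T} :
  UltraFilter F -> UltraFilter (f @ F).
Proof.
move=> UF; apply: ultra_decides => A.
exact: (in_ultra_setVsetC (f @^-1` A) UF).
Qed.

Lemma ultra_principal {T : Type} {F : set_system T} (x : T) :
  UltraFilter F -> F [set x] -> F = principal_filter x.
Proof.
move=> UF Fx; have Ux := principal_filter_ultra x.
by apply: max_filter => A /principal_filterP Ax; apply: filterS Fx => _ ->.
Qed.

Lemma omega1_complete_fmap {T U : Type} (f : T -> U) {F : set_system T} :
  omega1_complete F -> omega1_complete (f @ F).
Proof. by move=> oF B FB; exact: (oF (fun n => f @^-1` B n)). Qed.

Lemma omega1_complete_bigcup {T : Type} {F : set_system T} :
  UltraFilter F -> omega1_complete F ->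
  forall A : nat -> set T, F (\bigcup_n A n) -> exists n, F (A n).
Proof.
move=> UF oF A FA; apply: contrapT => /forallNP nFA.
apply: (filter_not_empty F).
have /(filterI FA) : F (\bigcap_n ~` A n).
  by apply: oF => n; apply/(ultra_complement UF).
by apply: filterS => x [[n _ Anx] /(_ n I)].
Qed.

(** [Ulam_measurable A] is [Ulam_type (set_type A)] by conversion. *)
Definition Ulam_type (X : Type) : Prop :=
  exists F : set_system X,
    [/\ UltraFilter F, omega1_complete F & forall x, F <> principal_filter x].

(** The form in which non-measurability is used: a map to a non-measurable
    type is constant on a set of the ultrafilter. *)
Lemma omega1_fibre {T X : Type} {F : set_system T} (f : T -> X) :
  UltraFilter F -> omega1_complete F -> ~ Ulam_type X ->
  exists x, F [set t | f t = x].
Proof.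
move=> UF oF nX; apply: contrapT => /forallNP nfib; apply: nX.
exists (f @ F); split; [exact: ultra_fmap|exact: omega1_complete_fmap|].
move=> x fFx; apply: (nfib x).
by have : (f @ F) [set x] by rewrite fFx; exact/principal_filterP.
Qed.

Lemma not_Ulam_nat : ~ Ulam_type nat.
Proof.
move=> [F [UF oF npF]].
have [|n Fn] := omega1_complete_bigcup UF oF (A := fun n => [set n]).
  by apply: filterS filterT => n _; exists n.
exact: (npF _ (ultra_principal UF Fn)).
Qed.

Lemma Ulam_type_inj {X Y : Type} (f : X -> Y) :
  injective f -> Ulam_type X -> Ulam_type Y.
Proof.
move=> injf [F [UF oF npF]]; apply: contrapT => nY.
have [y Fy] := omega1_fibre f UF oF nY.
have [x /= fx] := filter_ex Fy.
apply: (npF x); apply: (ultra_principal UF).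
by apply: filterS Fy => t /=; rewrite -fx; exact: injf.
Qed.

Lemma Ulam_type_prod {X Y : Type} :
  ~ Ulam_type Y -> Ulam_type (X * Y) -> Ulam_type X.
Proof.
move=> nY [F [UF oF npF]]; apply: contrapT => nX.
have [x Fx] := omega1_fibre fst UF oF nX.
have [y Fy] := omega1_fibre snd UF oF nY.
apply: (npF (x, y)); apply: (ultra_principal UF).
by apply: filterS (filterI Fx Fy) => -[a b] /= [-> ->].
Qed.

(** An ultrafilter on the subsets of [X] determines the set [A0] of the points
    that belong to almost every subset.  If it does not concentrate on [A0],
    then the choice of a point at which a subset differs from [A0] is, [X] being
    non-measurable, almost surely a fixed point [s], which contradicts the
    definition of [A0] at [s]. *)
Lemma Ulam_type_powerset {X : Type} : Ulam_type (set X) -> Ulam_type X.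
Proof.
move=> [F [UF oF npF]]; apply: contrapT => nX.
pose A0 : set X := [set s | F [set A | A s]].
(* Almost every subset agrees with [A0] at any given point. *)
have agree s : F [set A | A s <-> A0 s].
  have [FAs|] := in_ultra_setVsetC [set A : set X | A s] UF.
    by apply: filterS (FAs) => A As; split.
  move=> FnAs; apply: filterS (FnAs) => A nAs; split=> // FAs.
  by case: (filter_not_empty F); rewrite -(setICr [set A : set X | A s]);
    exact: filterI.
have FnA0 : F (~` [set A0]).
  by apply/(ultra_complement UF) => /(ultra_principal UF) /npF.
have differ A : A <> A0 -> exists s, ~ (A s <-> A0 s).
  move=> AA0; apply: contrapT => /forallNP same; apply: AA0.
  by apply/seteqP; split=> s; have /contrapT [] := same s.
have [A /differ[x0 _]] := filter_ex FnA0.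
have /choice[psi psiP] B : exists s, B <> A0 -> ~ (B s <-> A0 s).
  have [/differ[s ?]|/contrapT ->] := pselect (B <> A0).
    by exists s.
  by exists x0.
have [s Fs] := omega1_fibre psi UF oF nX.
apply: (filter_not_empty F).
apply: filterS (filterI FnA0 (filterI Fs (agree s))) => B [/psiP + [<-]].
exact.
Qed.

(** * Weights of neighbourhoods *)

(** A maximal set of pairwise everywhere distinct choice functions on the
    family projects onto one of the members, since otherwise the missing values
    form a further choice function.  That member injects into the maximal set,
    which injects into each of the members. *)
Lemma least_cardinality {X : Type} (B : set (set X)) : B !=set0 ->
  exists2 A, B A & forall A', B A' -> (A #<= A')%card.
Proof.
move=> [B0 BB0].
pose good (M : set (set X -> X)) :=
  (forall m, M m -> forall A, B A -> A (m A)) /\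
  (forall m m', M m -> M m' -> forall A, B A -> m A = m' A -> m = m').
have [M [[Mch Minj] Mmax]] : exists M, good M /\ forall N, M `<` N -> ~ good N.
  apply: Zorn_bigcup => C Cgood Ctot; split.
    by move=> m [M CM Mm]; exact: (Cgood _ CM).1.
  move=> m m' [M CM Mm] [M' CM' M'm'].
  have [MM'|M'M] := Ctot _ _ CM CM'.
    by apply: (Cgood _ CM').2 => //; exact: MM'.
  by apply: (Cgood _ CM).2 => //; exact: M'M.
have [A [BA onto]] : exists A, B A /\ forall a, A a -> exists2 m, M m & m A = a.
  apply: contrapT => /forallNP noA.
  have missed A : B A -> exists a, A a /\ forall m, M m -> m A <> a.
    move=> BA; apply: contrapT => none; apply: (noA A); split=> // a Aa.
    apply: contrapT => nm; apply: none; exists a; split=> // m Mm mA.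
    by apply: nm; exists m.
  have /choice[m0 m0P] A :
      exists a, B A -> A a /\ forall m, M m -> m A <> a.
    have [/missed[a aP]|nBA] := pselect (B A); first by exists a.
    by have [a _] := missed _ BB0; exists a.
  (* [m0] differs everywhere from all members of [M], against maximality. *)
  apply: (Mmax (M `|` [set m0])).
    split; first by left.
    move=> /(_ m0 (or_intror erefl)) Mm0.
    by case: (m0P _ BB0) => _ /(_ _ Mm0).
  split.
    by move=> m [Mm|->] A BA; [exact: (Mch _ Mm _ BA)|case: (m0P _ BA)].
  move=> m m' [Mm|->] [Mm'|->] A BA //.
  - by move=> mA; exact: (Minj _ _ Mm Mm' _ BA mA).
  - by case: (m0P _ BA) => _ /(_ _ Mm).
  - by case: (m0P _ BA) => _ /(_ _ Mm') + /esym.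
exists A => // A' BA'.
have /choice[sel selP] (a : A) : exists m, M m /\ m A = val a.
  case: a => a Aa /=; by have [m Mm mA] := onto a (set_mem Aa); exists m.
pose f (a : A) : A' := SigSub (mem_set (Mch _ (selP a).1 _ BA')).
apply/asboolP/injfunPex; exists f => // a b _ _ /(congr1 val) /= fab.
apply: val_inj; rewrite -(selP a).2 -(selP b).2.
by rewrite (Minj _ _ (selP a).1 (selP b).1 _ BA' fab).
Qed.

Lemma weight_exists (X : topologicalType) :
  exists K : set (set X), is_weight X K.
Proof.
have [|K bK minK] := @least_cardinality _ [set B : set (set X) | basis B].
  exists open; split=> // x A; rewrite nbhsE => -[B [oB Bx] BA].
  by exists B.
by exists K; split=> //; exists K.
Qed.

Lemma Ulam_type_weight {X : topologicalType} {T : Type} {K : set T}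
  {L : set (set X)} : (K #<= L)%card -> Ulam_measurable K -> Ulam_type X.
Proof.
move=> /asboolP/injfunPex[f _ injf] UK.
apply: Ulam_type_powerset; apply: (@Ulam_type_inj _ _ (val \o f)) UK.
by move=> a b /= /val_inj; apply: injf; rewrite inE.
Qed.

(** A base consists of subsets of [U], so its cardinality, and with it that of
    [kappa], is at most that of the powerset of [U]. *)
Lemma Ulam_type_nbhs {G : topologicalGroupType} {T : Type} {kappa : set T} :
  is_local_weight G kappa -> Ulam_measurable kappa ->
  forall U : set G, nbhs (1%g : G) U -> Ulam_type U.
Proof.
move=> [_ least] Uk U nU; have [L wL] := weight_exists U.
exact: Ulam_type_weight (least U nU L wL) Uk.
Qed.

(** * Group topologies given by the neighbourhoods of the neutral element *)

Section GroupFilters.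
Local Open Scope group_scope.

(** These conditions characterize the neighbourhood filters of the neutral element
    in Hausdorff group topologies. *)
Record group_filter (A : groupType) (N : set_system A) : Prop := GroupFilter {
  group_filter_filter : Filter N;
  group_filter_one : forall W, N W -> W 1;
  group_filter_div : forall W, N W ->
    exists2 W', N W' & forall x y, W' x -> W' y -> W (x^-1 * y);
  group_filter_conj : forall (g : A) W, N W -> N [set x | W (g * x * g^-1)];
  group_filter_sep : forall x, (forall W, N W -> W x) -> x = 1
}.

Context {A : groupType} {N : set_system A} (NF : group_filter N).
Let filterN := group_filter_filter NF.
Local Existing Instance filterN.

Lemma group_filter_inv W : N W -> N [set x | W x^-1].
Proof.
move=> /(group_filter_div NF)[W' NW' W'P].
apply: filterS (NW') => x W'x /=; rewrite -[x^-1]mulg1; apply: W'P => //.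
exact: (group_filter_one NF).
Qed.

Lemma group_filter_mul W : N W ->
  exists2 W', N W' & forall x y, W' x -> W' y -> W (x * y).
Proof.
move=> /(group_filter_div NF)[W' NW' W'P].
exists ([set x | W' x^-1] `&` W').
  by apply: filterI => //; exact: group_filter_inv.
by move=> x y [W'x _] [_ W'y]; rewrite -[x]invgK; exact: W'P.
Qed.

(** An alias of [A], indexed by the proof, to which the topology is attached. *)
Definition group_of_filter & group_filter N : Type := A.
Local Notation T := (group_of_filter NF).

HB.instance Definition _ := Group.on T.
HB.instance Definition _ :=
  hasNbhs.Build T (fun x B => N [set w | B (x * w)]).

Lemma group_of_filterE (x : T) (B : set T) :
  nbhs x B = N [set w : A | B (x * w)].
Proof. by []. Qed.

Fact group_of_filter_proper (x : T) : ProperFilter (nbhs x).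
Proof.
split; first by rewrite group_of_filterE => /(group_filter_one NF).
split; rewrite ?group_of_filterE.
- exact: filterT.
- by move=> B C; rewrite !group_of_filterE; exact: filterI.
- move=> B C BC; rewrite !group_of_filterE; apply: filterS => w; exact: BC.
Qed.

Fact group_of_filter_singleton (x : T) (B : set T) : nbhs x B -> B x.
Proof.
by rewrite group_of_filterE => /(group_filter_one NF) /=; rewrite mulg1.
Qed.

Fact group_of_filter_nbhs (x : T) (B : set T) : nbhs x B -> nbhs x (nbhs^~ B).
Proof.
rewrite !group_of_filterE => /group_filter_mul[W NW WP].
apply: filterS (NW) => w Ww /=; rewrite group_of_filterE.
by apply: filterS (NW) => v Wv /=; rewrite -mulgA; exact: WP.
Qed.

HB.instance Definition _ := Nbhs_isNbhsTopological.Build T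
  group_of_filter_proper group_of_filter_singleton group_of_filter_nbhs.

Lemma group_of_filter_nbhs1 (B : set T) : nbhs (1 : T) B = N B.
Proof.
rewrite group_of_filterE; congr (N _).
by apply/funext => w /=; rewrite mul1g.
Qed.

Fact group_of_filter_topology : @group_topology T (Topological.class T).
Proof.
split.
- move=> p q clq; rewrite -[LHS]mulg1.
  suff <- : p^-1 * q = 1 by rewrite mulVKg.
  apply: (group_filter_sep NF) => W /(group_filter_div NF)[W' NW' W'P].
  have [||z [/= W1 W2]] := clq [set z : T | W' (p^-1 * z)^-1]
      [set z : T | W' (q^-1 * z)^-1]; rewrite ?group_of_filterE.
  + apply: filterS (group_filter_inv NW') => w /=.
    by rewrite mulKg.
  + apply: filterS (group_filter_inv NW') => w /=.
    by rewrite mulKg.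
  have := W'P _ _ W1 W2; rewrite !invgK invgM invgK.
  by rewrite mulgA mulgK.
- move=> [x y] B /=; rewrite [nbhs _ B]group_of_filterE => NB.
  have [W NW WP] := group_filter_mul NB.
  exists ([set u | W (y^-1 * (x^-1 * u) * y)], [set v | W (y^-1 * v)]).
    split; rewrite /= group_of_filterE /=.
      have := group_filter_conj NF y^-1 NW; apply: filterS => w /=.
      by rewrite mulKg invgK.
    by apply: filterS (NW) => w /=; rewrite mulKg.
  move=> [u v] [/= Wu Wv]; have := WP _ _ Wu Wv => /=.
  by rewrite !mulgA !mulgK mulgV mul1g.
- move=> x B /=; rewrite [nbhs _ B]group_of_filterE => NB.
  change (N [set w | B ((x * w)^-1 : T)]).
  have := group_filter_conj NF x (group_filter_inv NB).
  apply: filterS => w /=; rewrite !invgM invgK.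
  by rewrite mulKg.
Qed.

HB.instance Definition _ := isTopologicalGroup.Build T group_of_filter_topology.

End GroupFilters.

Section TopologicalGroups.
Local Open Scope group_scope.
Context {G : topologicalGroupType}.

Lemma topological_group_hausdorff : hausdorff_space G.
Proof. by have [] := @group_topology_subproof G. Qed.

Lemma topological_group_mul_continuous :
  continuous (fun z : G * G => z.1 * z.2).
Proof. by have [] := @group_topology_subproof G. Qed.

Lemma topological_group_inv_continuous : continuous (fun x : G => x^-1).
Proof. by have [] := @group_topology_subproof G. Qed.

Lemma mulg_continuousl (x : G) : continuous (fun y : G => x * y).
Proof.
move=> y; apply: (@continuous2_cvg _ G G G _ _ (fun=> x) id _ x y).
- exact: (@topological_group_mul_continuous (x, y)).
- exact: cvg_cst.
- exact: cvg_id.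
Qed.

Lemma mulg_continuousr (x : G) : continuous (fun y : G => y * x).
Proof.
move=> y; apply: (@continuous2_cvg _ G G G _ _ id (fun=> x) _ y x).
- exact: (@topological_group_mul_continuous (y, x)).
- exact: cvg_id.
- exact: cvg_cst.
Qed.

Lemma nbhs_translate (x : G) (A : set G) :
  nbhs x A <-> nbhs (1 : G) [set w | A (x * w)].
Proof.
split=> [nA|nA].
  have /= := @mulg_continuousl x 1 A; rewrite mulg1; exact.
have /= := @mulg_continuousl x^-1 x [set w | A (x * w)].
rewrite mulVg => /(_ nA); rewrite nbhs_simpl /=.
by apply: filterS => z /=; rewrite mulVKg.
Qed.

Lemma group_filter_nbhs : group_filter (nbhs (1 : G)).
Proof.
split.
- exact: nbhs_filter.
- by move=> W; exact: nbhs_singleton.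
- move=> W nW.
  have : nbhs ((1 : G)^-1 * 1) W by rewrite mulVg.
  have cd : (fun z : G * G => z.1^-1 * z.2) z @[z --> (1 : G, 1 : G)]
              --> (1 : G)^-1 * 1.
    apply: (@continuous2_cvg _ G G G _ _ (fun z : G * G => z.1^-1) snd).
    + exact: (@topological_group_mul_continuous (1^-1, 1)).
    + apply: (@cvg_comp _ _ _ fst (fun x : G => x^-1)); first exact: cvg_fst.
      exact: topological_group_inv_continuous.
    + exact: cvg_snd.
  move=> /cd [[P Q] /= [nP nQ] PQ]; exists (P `&` Q); first exact: filterI.
  by move=> x y [Px _] [_ Qy]; exact: (PQ (x, y)).
- move=> g W nW.
  have : nbhs (g * 1 * g^-1) W by rewrite mulg1 mulgV.
  move=> /(@mulg_continuousr g^-1 (g * 1)); rewrite nbhs_simpl /=.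
  exact: (@mulg_continuousl g 1).
- move=> x nx; apply: topological_group_hausdorff => A B nA nB.
  by exists x; split; [exact: nbhs_singleton|exact: nx].
Qed.

End TopologicalGroups.

(** * The topology of an ultrapower *)

Section UltrapowerTopology.
Local Open Scope group_scope.
Context {A : groupType} {N : set_system A} {I : Type} {F : set_system I}.

(** These are the traces on the diagonal of the neighbourhoods of the neutral
    element in the ultrapower of [A]. *)
Definition ultra_nbhs : set_system A :=
  [set B | exists2 W : I -> set A, (forall i, N (W i)) &
    [set x | F [set i | W i x]] `<=` B].

Lemma ultra_nbhs_family (W : I -> set A) :
  (forall i, N (W i)) -> ultra_nbhs [set x | F [set i | W i x]].
Proof. by move=> NW; exists W. Qed.

Hypothesis PF : ProperFilter F.

Lemma ultra_nbhs_finer : N `<=` ultra_nbhs.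
Proof.
move=> W NW; exists (fun=> W) => // x /= FW.
by have [] := filter_ex FW.
Qed.

Hypothesis NF : group_filter N.
Let filterN := group_filter_filter NF.
Local Existing Instance filterN.

Lemma group_filter_ultra_nbhs : group_filter ultra_nbhs.
Proof.
split.
- split.
  + by apply: ultra_nbhs_finer; exact: filterT.
  + move=> B C [W NW WB] [W' NW' WC].
    exists (fun i => W i `&` W' i) => [i|x /= FWW']; first exact: filterI.
    by split; [apply: WB|apply: WC]; apply: filterS FWW' => i [].
  + by move=> B C BC [W NW WB]; exists W => //; exact: subset_trans WB BC.
- move=> B [W NW WB]; apply: WB => /=; apply: filterS filterT => i _.
  exact: (group_filter_one NF).
- move=> B [W NW WB].
  have /choice[W' W'P] i : exists W', N W' /\
      forall x y, W' x -> W' y -> W i (x^-1 * y).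
    by have [W' ? ?] := group_filter_div NF (NW i); exists W'.
  exists [set x | F [set i | W' i x]].
    by apply: ultra_nbhs_family => i; exact: (W'P i).1.
  move=> x y Fx Fy; apply: WB => /=; apply: filterS (filterI Fx Fy) => i /= [].
  exact: (W'P i).2.
- move=> g B [W NW WB].
  exists (fun i => [set x | W i (g * x * g^-1)]) => [i|x /= Fx].
    exact: (group_filter_conj NF).
  exact: WB.
- move=> x Bx; apply: (group_filter_sep NF) => W NW.
  by apply: Bx; exact: ultra_nbhs_finer.
Qed.

End UltrapowerTopology.

Section CountablyCompleteUltrapower.
Local Open Scope group_scope.
Context {A : groupType} {N : set_system A} {I : Type} {F : set_system I}.
Hypotheses (UF : UltraFilter F) (oF : omega1_complete F).

(** The trace on [S] of the translate of [W i] depends on [i] as a map to the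
    powerset of [S] does, so it is almost surely constant. *)
Lemma ultra_nbhs_trace (S : set A) (x : A) (W : I -> set A) :
  ~ Ulam_measurable S -> (forall i, N (W i)) ->
  exists2 V, N V &
    forall s, S s -> V (x^-1 * s) -> F [set i | W i (x^-1 * s)].
Proof.
move=> nS NW; pose tr i : set (set_type S) := [set s | W i (x^-1 * \val s)].
have [|T FT] := omega1_fibre tr UF oF.
  by move=> /Ulam_type_powerset.
have [i /= iT] := filter_ex FT.
exists (W i) => // s Ss Wis; apply: filterS FT => j /= jT.
have : tr i (SigSub (mem_set Ss)) by [].
by rewrite iT -jT.
Qed.

(** Countable completeness makes the rank from which [u] stays in [W i] uniform
    for almost every [i]. *)
Lemma ultra_nbhs_sequence (u : nat -> A) (B : set A) :
  (forall W, N W -> \forall n \near \oo, W (u n)) ->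
  ultra_nbhs (N := N) (F := F) B ->
  \forall n \near \oo, B (u n).
Proof.
move=> cvu [W NW WB].
have [m Fm] : exists m, F [set i | forall n, (m <= n)%N -> W i (u n)].
  apply: omega1_complete_bigcup => //; apply: filterS filterT => i _.
  by have [m _ mP] := cvu _ (NW i); exists m.
exists m => // n /= mn; apply: WB => /=.
by apply: filterS Fm => i; exact.
Qed.

End CountablyCompleteUltrapower.

Section TotallyBounded.
Local Open Scope group_scope.

(** Finite covers by translates are encoded as colourings with finitely many
    colours, because the limit of colourings along an ultrafilter is again a
    colouring, whereas the limit of finite sets of centres need not consist of
    elements of the group. *)
Definition totally_bounded (A : groupType) (N : set_system A) (V : set A) :=
  forall W, N W -> exists (n : nat) (c : A -> nat),
    (forall x, V x -> (c x < n)%N) /\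
    (forall x y, V x -> V y -> c x = c y -> W (x^-1 * y)).

Lemma totally_bounded_ultra_nbhs (A : groupType) (N : set_system A)
  (I : Type) (F : set_system I) (V : set A) :
  UltraFilter F -> omega1_complete F ->
  totally_bounded N V -> totally_bounded (@ultra_nbhs A N I F) V.
Proof.
move=> UF oF tbV B [W NW WB].
have /choice[n nP] i : exists n, exists c : A -> nat,
    (forall x, V x -> (c x < n)%N) /\
    (forall x y, V x -> V y -> c x = c y -> W i (x^-1 * y)) := tbV _ (NW i).
have /choice[c cP] := nP.
have [m Fm] := omega1_fibre n UF oF not_Ulam_nat.
have /choice[k kP] x := omega1_fibre (c ^~ x) UF oF not_Ulam_nat.
exists m, k; split.
  move=> x Vx; have [i /= [<- <-]] := filter_ex (filterI Fm (kP x)).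
  exact: (cP i).1.
move=> x y Vx Vy kxy; apply: WB => /=.
apply: filterS (filterI (kP x) (kP y)) => i /= [ix iy].
by apply: (cP i).2 => //; rewrite ix iy.
Qed.

(** The colour of a point is the rank of the first translate that contains it. *)
Lemma compact_totally_bounded (G : topologicalGroupType) (V : set G) :
  compact V -> totally_bounded (nbhs (1 : G)) V.
Proof.
move=> /compact_near_coveringP cV W nW.
have [W' nW' W'P] := group_filter_div group_filter_nbhs nW.
pose near_to (y x : G) := `[< W' (x^-1 * y) >].
pose containing (s0 : seq G) := [set s : seq G | {subset s0 <= s}].
have FF : Filter (filter_from [set: seq G] containing).
  apply: filter_from_filter; first by exists [::].
  move=> s t _ _; exists (s ++ t) => // r str.
  by split=> x xs; apply: str; rewrite mem_cat xs ?orbT.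
have [x Vx|s0 _ /(_ s0) cov] := cV _ _ (fun s y => has (near_to y) s) FF.
  exists ([set y | W' (x^-1 * y)], containing [:: x]) => /=.
    split; last by exists [:: x].
    by apply/nbhs_translate; apply: filterS nW' => w /=; rewrite mulKg.
  move=> [y s] /= [W'xy xs]; apply/hasP; exists x; last exact/asboolP.
  by apply: xs; rewrite mem_head.
exists (size s0), (fun y => find (near_to y) s0); split=> [y Vy|y z Vy Vz yz].
  by rewrite -has_find; exact: cov.
have in_ball t : V t -> W' ((nth 1 s0 (find (near_to t) s0))^-1 * t).
  by move=> Vt; apply/asboolP/(nth_find 1 (a := near_to t))/cov.
have := W'P _ _ (in_ball _ Vy) (in_ball _ Vz); rewrite yz.
by rewrite invgM invgK mulgA mulgK.
Qed.

End TotallyBounded.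

(** * Completion of a locally totally bounded group *)

(** On the choice functions of the filters on [X], any ultrafilter that contains
    all boxes realizes every filter by the evaluation map at this filter. *)
Lemma ultrafilter_realizing_filters (X : Type) (x0 : X) :
  exists (J : Type) (U : set_system J), UltraFilter U /\
    forall phi : set_system X, ProperFilter phi ->
      exists e : J -> X, forall B, phi B -> U [set j | B (e j)].
Proof.
pose J := set_system X -> X.
pose boxes := [set s : set_system X -> set X |
  forall phi, ProperFilter phi -> phi (s phi)].
pose box (s : set_system X -> set X) :=
  [set j : J | forall phi, ProperFilter phi -> s phi (j phi)].
have Pbox : ProperFilter (filter_from boxes box).
  apply: filter_from_proper.
    apply: filter_from_filter.
      by exists (fun=> setT) => phi Pphi; exact: filterT.
    move=> s t Bs Bt; exists (fun phi => s phi `&` t phi).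
      by move=> phi Pphi; apply: filterI; [exact: Bs|exact: Bt].
    by move=> j jst; split=> phi /jst [].
  move=> s Bs; have /choice[j jP] phi : exists x, ProperFilter phi -> s phi x.
    have [Pphi|nP] := pselect (ProperFilter phi); last by exists x0.
    by have [x sx] := filter_ex (Bs phi Pphi); exists x.
  by exists j.
have [U [UU boxU]] := ultraFilterLemma Pbox.
exists J, U; split=> // phi Pphi; exists (fun j => j phi) => B phiB.
apply: boxU; exists (fun psi => [set x | psi = phi -> B x]).
  move=> psi Ppsi; have [->|ne] := pselect (psi = phi).
    by apply: filterS phiB => x Bx _.
  by apply: filterS filterT => x _.
by move=> j /(_ phi Pphi); exact.
Qed.

Lemma ultra_pigeonhole {T : Type} {F : set_system T} (f : T -> nat) (n : nat) :
  UltraFilter F -> F [set t | (f t < n)%N] -> exists k, F [set t | f t = k].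
Proof.
move=> UF; elim: n => [|n IHn] Fn; first by have [t] := filter_ex Fn.
have [Fk|/(ultra_complement UF) Fk] := pselect (F [set t | f t = n]).
  by exists n.
apply: IHn; apply: filterS (filterI Fn Fk) => t /= [].
by rewrite ltnS leq_eqVlt => /orP[/eqP|].
Qed.

Section Completion.
Local Open Scope group_scope.
Local Open Scope quotient_scope.
Context {A : groupType} {N : set_system A} (NF : group_filter N).
Let filterN := group_filter_filter NF.
Local Existing Instance filterN.
Context {V : set A} (NV : N V) (tbV : totally_bounded N V).
Context {J : Type} {U : set_system J} (UU : UltraFilter U).
Hypothesis realize : forall phi : set_system A, ProperFilter phi ->
  exists e : J -> A, forall B, phi B -> U [set j | B (e j)].

Implicit Types (W : set A) (a b : J -> A).

(** The elements of the ultrapower that determine a Cauchy filter on [A]. *)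
Definition near_standard : set (J -> A) :=
  [set a | forall W, N W -> exists g, U [set j | W (g^-1 * a j)]].

Definition infinitesimal : set (J -> A) :=
  [set a | forall W, N W -> U [set j | W (a j)]].

Lemma near_standard_cst (g : A) : near_standard (fun=> g).
Proof.
move=> W NW; exists g; apply: filterS filterT => j _ /=; rewrite mulVg.
exact: (group_filter_one NF).
Qed.

(** Almost every value of [a] has the same colour, so any one of them serves as
    the centre [g]. *)
Lemma near_standard_local a : U [set j | V (a j)] -> near_standard a.
Proof.
move=> UV W NW; have [n [c [cn cW]]] := tbV NW.
have [k Uk] : exists k, U [set j | c (a j) = k].
  by apply: (ultra_pigeonhole UU (n := n)); apply: filterS UV => j; exact: cn.
have [j0 [/= Vj0 cj0]] := filter_ex (filterI UV Uk).
exists (a j0); apply: filterS (filterI UV Uk) => j /= [Vj cj].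
by apply: cW => //; rewrite cj0 cj.
Qed.

Lemma near_standard_mul a b :
  near_standard a -> near_standard b -> near_standard (fun j => a j * b j).
Proof.
move=> sa sb W NW; have [W1 NW1 W1P] := group_filter_mul NF NW.
have [h Uh] := sb _ NW1.
have [g Ug] := sa _ (group_filter_conj NF h^-1 NW1).
exists (g * h); apply: filterS (filterI Ug Uh) => j /= [Wa Wb].
have := W1P _ _ Wa Wb; rewrite invgK invgM.
by rewrite !mulgA mulgK.
Qed.

(** Near [g], the inverse lies in a translate of [V], where it can be
    approximated from the left because [V] is totally bounded. *)
Lemma near_standard_inv a :
  near_standard a -> near_standard (fun j => (a j)^-1).
Proof.
move=> sa W NW; have [g Ug] := sa _ (group_filter_inv NF NV).
have /near_standard_local sag : U [set j | V ((a j)^-1 * g)].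
  by apply: filterS Ug => j /=; rewrite invgM invgK.
have [h Uh] := sag _ (group_filter_conj NF g NW).
exists (h * g^-1); apply: filterS Uh => j /=.
by rewrite !mulgA mulgK invgM invgK.
Qed.

(** The neighbourhood [W'] must not depend on the small factor of [a], which is
    why [a] is approximated from the right, by [a = u^-1 * h^-1] with [u] small:
    conjugation by the constant [h^-1] comes first, and then conjugation by
    [u^-1], uniformly in [u]. *)
Lemma near_standard_conj a W : near_standard a -> N W ->
  exists2 W', N W' & forall b, U [set j | W' (b j)] ->
    U [set j | W (a j * b j * (a j)^-1)].
Proof.
move=> sa NW; have [W2 NW2 W2P] := group_filter_mul NF NW.
have [W1 NW1 W1P] := group_filter_div NF NW2.
have [h Uh] := near_standard_inv sa (filterI NW1 NW2).
exists [set x | W1 (h^-1 * x * h^-1^-1)]; first exact: (group_filter_conj NF).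
move=> b Ub; apply: filterS (filterI Uh Ub) => j /= [[W1u W2u] W1b].
have := W2P _ _ (W1P _ _ W1u W1b) W2u.
by rewrite !invgM !invgK !mulgA !mulgK.
Qed.

Lemma infinitesimal_mul a b :
  infinitesimal a -> infinitesimal b -> infinitesimal (fun j => a j * b j).
Proof.
move=> ia ib W /(group_filter_mul NF)[W' NW' W'P].
by apply: filterS (filterI (ia _ NW') (ib _ NW')) => j /= []; exact: W'P.
Qed.

Lemma infinitesimal_inv a :
  infinitesimal a -> infinitesimal (fun j => (a j)^-1).
Proof. by move=> ia W NW; exact: ia _ (group_filter_inv NF NW). Qed.

Lemma infinitesimal_conj a b : near_standard a -> infinitesimal b ->
  infinitesimal (fun j => a j * b j * (a j)^-1).
Proof.
move=> sa ib W NW; have [W' NW' W'P] := near_standard_conj sa NW.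
exact: W'P (ib _ NW').
Qed.

(** ** The group of near-standard points modulo infinitesimals *)

Definition near_standard_type : Type := set_type near_standard.
Implicit Types x y z : near_standard_type.

HB.instance Definition _ := Choice.on near_standard_type.

Definition Near a (sa : near_standard a) : near_standard_type :=
  SigSub (mem_set sa).
Definition near_val x : J -> A := val x.

Lemma near_valP x : near_standard (near_val x).
Proof. exact: set_mem (valP x). Qed.

Definition near_mul x y := Near (near_standard_mul (near_valP x) (near_valP y)).
Definition near_inv x := Near (near_standard_inv (near_valP x)).
Definition near_cst g := Near (near_standard_cst g).

Definition infinitely_close x y : bool :=
  `[< infinitesimal (fun j => (near_val x j)^-1 * near_val y j) >].

Lemma infinitely_close_equiv :
  equiv_class_of infinitely_close.
Proof.
split.
- move=> x; apply/asboolP => W NW; apply: filterS filterT => j _ /=.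
  by rewrite mulVg; exact: (group_filter_one NF).
- suff sym x y : infinitely_close x y -> infinitely_close y x.
    by move=> x y; apply/idP/idP; exact: sym.
  move=> /asboolP xy; apply/asboolP => W NW.
  by have := infinitesimal_inv xy NW; apply: filterS => j /=; rewrite invgM invgK.
- move=> y x z /asboolP xy /asboolP yz; apply/asboolP => W NW.
  have := infinitesimal_mul xy yz NW; apply: filterS => j /=.
  by rewrite mulgA mulgK.
Qed.

Canonical infinitely_close_rel := EquivRelPack infinitely_close_equiv.

Definition completion : Type := {eq_quot infinitely_close}.
HB.instance Definition _ := Choice.on completion.

Definition completion_class x : completion := \pi_({eq_quot infinitely_close}) x.

Lemma completion_classP x y :
  completion_class x = completion_class y <->
  infinitesimal (fun j => (near_val x j)^-1 * near_val y j).
Proof.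
split=> [/eqmodP/asboolP //|xy].
exact/eqmodP/asboolP.
Qed.

Lemma completion_class_surj (h : completion) : exists x, completion_class x = h.
Proof. by exists (repr h); rewrite /completion_class reprK. Qed.

Definition completion_mul (h k : completion) : completion :=
  completion_class (near_mul (repr h) (repr k)).
Definition completion_inv (h : completion) : completion :=
  completion_class (near_inv (repr h)).
Definition completion_one : completion := completion_class (near_cst 1).

Lemma completion_mulE x y :
  completion_mul (completion_class x) (completion_class y) =
  completion_class (near_mul x y).
Proof.
have /completion_classP := reprK (completion_class x).
set x' := repr _ => xx'.
have /completion_classP := reprK (completion_class y).
set y' := repr _ => yy'.
apply/completion_classP => W NW.
have sy' := near_standard_inv (near_valP y').
have := infinitesimal_mul (infinitesimal_conj sy' xx') yy' NW.
by apply: filterS => j /=; rewrite invgK invgM !mulgA mulgK.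
Qed.

Lemma completion_invE x :
  completion_inv (completion_class x) = completion_class (near_inv x).
Proof.
have /completion_classP := reprK (completion_class x).
set x' := repr _ => xx'.
apply/completion_classP => W NW.
have := infinitesimal_conj (near_valP x') (infinitesimal_inv xx') NW.
by apply: filterS => j /=; rewrite invgM !invgK !mulgA mulgK.
Qed.

Lemma completion_class_ext x y :
  (forall j, near_val x j = near_val y j) ->
  completion_class x = completion_class y.
Proof. by move=> xy; congr completion_class; apply/val_inj/funext. Qed.

Fact completion_mulA : associative completion_mul.
Proof.
move=> h k l; have [x <-] := completion_class_surj h.
have [y <-] := completion_class_surj k; have [z <-] := completion_class_surj l.
rewrite !completion_mulE; apply: completion_class_ext => j /=.
exact: mulgA.
Qed.

Fact completion_mul1 : left_id completion_one completion_mul.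
Proof.
move=> h; have [x <-] := completion_class_surj h.
rewrite completion_mulE; apply: completion_class_ext => j /=; exact: mul1g.
Qed.

Fact completion_mulg1 : right_id completion_one completion_mul.
Proof.
move=> h; have [x <-] := completion_class_surj h.
rewrite completion_mulE; apply: completion_class_ext => j /=; exact: mulg1.
Qed.

Fact completion_mulV : left_inverse completion_one completion_inv completion_mul.
Proof.
move=> h; have [x <-] := completion_class_surj h.
rewrite completion_invE completion_mulE.
apply: completion_class_ext => j /=; exact: mulVg.
Qed.

Fact completion_mulgV :
  right_inverse completion_one completion_inv completion_mul.
Proof.
move=> h; have [x <-] := completion_class_surj h.
rewrite completion_invE completion_mulE.
apply: completion_class_ext => j /=; exact: mulgV.
Qed.

HB.instance Definition _ := isGroup.Build completion completion_mulA
  completion_mul1 completion_mulg1 completion_mulV completion_mulgV.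

Lemma completion_class_mul x y :
  completion_class x * completion_class y = completion_class (near_mul x y).
Proof. exact: completion_mulE. Qed.

Lemma completion_class_inv x :
  (completion_class x)^-1 = completion_class (near_inv x).
Proof. exact: completion_invE. Qed.

Definition completion_nbhs : set_system completion :=
  [set B | exists2 W, N W &
    forall x, U [set j | W (near_val x j)] -> B (completion_class x)].

(** The index filter being an ultrafilter, the classes of the points that lie
    almost everywhere in [W] play the role of the closure of [W]. *)
Definition completion_lift W : set completion :=
  [set h | exists2 x, completion_class x = h & U [set j | W (near_val x j)]].

Lemma completion_nbhs_lift W : N W -> completion_nbhs (completion_lift W).
Proof. by move=> NW; exists W => // x Ux; exists x. Qed.

Lemma group_filter_completion : group_filter completion_nbhs.
Proof.
split.
- split.
  + by exists setT => //; exact: filterT.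
  + move=> B C [W NW WB] [W' NW' WC].
    exists (W `&` W') => [|x UWW']; first exact: filterI.
    by split; [apply: WB|apply: WC]; apply: filterS UWW' => j [].
  + by move=> B C BC [W NW WB]; exists W => // x Ux; exact/BC/WB.
- move=> B [W NW WB]; apply: WB; apply: filterS filterT => j _.
  exact: (group_filter_one NF).
- move=> B [W NW WB]; have [W' NW' W'P] := group_filter_div NF NW.
  exists (completion_lift W').
    exact: completion_nbhs_lift.
  move=> _ _ [x <- Ux] [y <- Uy].
  rewrite completion_class_inv completion_class_mul; apply: WB.
  by apply: filterS (filterI Ux Uy) => j /= []; exact: W'P.
- move=> h B [W NW WB]; have [z <-] := completion_class_surj h.
  have [W' NW' W'P] := near_standard_conj (near_valP z) NW.
  exists W' => // x Ux /=.
  rewrite completion_class_inv (completion_class_mul z x) completion_class_mul.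
  apply: WB.
  exact: (W'P (near_val x) Ux).
- move=> h hP; have [x xh] := completion_class_surj h.
  rewrite -xh; apply/esym/completion_classP => W NW.
  have [W' NW' W'P] := group_filter_mul NF NW.
  have [y] := hP _ (completion_nbhs_lift NW').
  rewrite -xh => /completion_classP yx Uy.
  apply: filterS (filterI Uy (yx _ NW')) => j /= [Wy Wyx].
  by have := W'P _ _ Wy Wyx; rewrite invg1 mul1g mulVKg.
Qed.

Definition completion_group : topologicalGroupType :=
  group_of_filter group_filter_completion.

Definition to_completion (g : A) : completion_group :=
  completion_class (near_cst g).

Fact to_completion_mul : {morph to_completion : g h / g * h}.
Proof.
move=> g h; transitivity (completion_class (near_mul (near_cst g) (near_cst h))).
  exact: completion_class_ext.
by apply/esym; exact: completion_mulE.
Qed.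

HB.instance Definition _ :=
  isMultiplicative.Build A completion_group to_completion to_completion_mul.

Lemma to_completion_preimage (B : set completion_group) :
  nbhs (1 : completion_group) B -> N (to_completion @^-1` B).
Proof.
rewrite group_of_filter_nbhs1 => -[W NW WB]; apply: filterS NW => g Wg.
by apply: WB; apply: filterS filterT.
Qed.

Lemma to_completion_nbhs W : N W ->
  exists2 B, nbhs (1 : completion_group) B & to_completion @^-1` B `<=` W.
Proof.
move=> /(group_filter_mul NF)[W' NW' W'P].
exists (completion_lift W').
  rewrite group_of_filter_nbhs1; exact: completion_nbhs_lift NW'.
move=> g /= [x /completion_classP xg Ux].
have [j /= [Wx Wxg]] := filter_ex (filterI Ux (xg _ NW')).
by have := W'P _ _ Wx Wxg; rewrite mulVKg.
Qed.

(** An ultrafilter on classes of points of [V] is carried by representatives to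
    an ultrafilter on [A] that contains [V]; a point of the ultrapower that
    realizes the latter is a limit of the former. *)
Lemma completion_lift_compact :
  compact (completion_lift V : set completion_group).
Proof.
rewrite compact_ultra /= => Phi UPhi PhiK.
have /choice[r rP] (h : completion) : exists x, completion_class x = h /\
    (completion_lift V h -> U [set j | V (near_val x j)]).
  have [[x xh Ux]|nK] := pselect (completion_lift V h); first by exists x.
  by have [x xh] := completion_class_surj h; exists x.
pose phi : set_system A :=
  [set B | Phi [set h | U [set j | B (near_val (r h) j)]]].
have phiE B : phi B = Phi [set h | U [set j | B (near_val (r h) j)]] by [].
have Pphi : ProperFilter phi.
  split.
    move=> phi0; have [h /=] : exists h : completion, U set0.
      exact: (filter_ex (phi0 : Phi [set h | U set0])).
    exact: filter_not_empty.
  split.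
  - by rewrite phiE; apply: filterS filterT => h _; exact: filterT.
  - move=> B C; rewrite !phiE => PB PC.
    by apply: filterS (filterI PB PC) => h /= []; exact: filterI.
  - move=> B C BC; rewrite !phiE.
    by apply: filterS => h; apply: filterS => j; exact: BC.
have Uphi : UltraFilter phi.
  apply: ultra_decides => B; rewrite !phiE.
  have [|PnB] :=
    in_ultra_setVsetC [set h | U [set j | B (near_val (r h) j)]] UPhi.
    by left.
  by right; apply: filterS PnB => h /= /(ultra_complement UU).
have phiV : phi V.
  by rewrite phiE; apply: filterS PhiK => h; exact: (rP h).2.
have [e eP] := realize Pphi.
have se := near_standard_local (eP _ phiV).
exists (completion_class (Near se)); split.
  by exists (Near se) => //; exact: eP.
move=> B; rewrite group_of_filterE => -[W NW WB].
have [W' NW' W'P] := group_filter_div NF NW.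
have [n [c [cn cW]]] := tbV NW'.
have [k phik] : exists k, phi [set v | c v = k].
  by apply: (ultra_pigeonhole Uphi (n := n)); apply: filterS phiV.
have [g [Vg cg]] := filter_ex (filterI phiV phik).
have phig : phi [set v | W' (g^-1 * v)].
  apply: filterS (filterI phiV phik) => v [Vv cv].
  by apply: cW => //; rewrite cg cv.
have phig' := phig; rewrite phiE in phig'; apply: filterS (phig') => h Uh.
rewrite -(rP h).1.
have -> : completion_class (r h) =
    completion_class (near_mul (Near se) (near_mul (near_inv (Near se)) (r h))).
  by apply: completion_class_ext => j; apply/esym; exact: mulVKg.
rewrite -completion_mulE; apply: WB.
apply: filterS (filterI (eP _ phig) Uh) => j /= [We Wr].
by have := W'P _ _ We Wr; rewrite invgM invgK mulgA mulgK.
Qed.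

Lemma completion_locally_compact : locally_compact [set: completion_group].
Proof.
move=> h _.
pose K : set completion_group := completion_lift V.
have cK : compact [set h * k | k in K].
  apply: continuous_compact completion_lift_compact.
  exact/continuous_subspaceT/mulg_continuousl.
exists [set h * k | k in K].
  have : nbhs h [set h * k | k in K].
    apply/nbhs_translate; rewrite group_of_filter_nbhs1.
    have FH := group_filter_filter group_filter_completion.
    by apply: filterS (completion_nbhs_lift NV) => k Kk; exists k.
  by apply: filterS => k Kk _.
split=> //; apply: compact_closed cK.
exact: topological_group_hausdorff.
Qed.

End Completion.

(** Every locally totally bounded group embeds topologically in a locally
    compact group. *)
Lemma locally_compact_completion (A : groupType) (N : set_system A)
    (V : set A) : group_filter N -> N V -> totally_bounded N V ->
  exists (H : topologicalGroupType) (f : {multiplicative A -> H}),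
    [/\ locally_compact [set: H],
        forall B, nbhs (1%g : H) B -> N (f @^-1` B) &
        forall W, N W -> exists2 B, nbhs (1%g : H) B & f @^-1` B `<=` W].
Proof.
move=> NF NV tbV.
have [J [U [UU realize]]] := ultrafilter_realizing_filters (1%g : A).
exists (completion_group NF NV tbV UU), (to_completion NF NV tbV UU).
split.
- exact: completion_locally_compact.
- exact: to_completion_preimage.
- exact: to_completion_nbhs.
Qed.

(** * Strictness of the ultrapower topology *)

Record strict_well_order (I : Type) (lt : I -> I -> Prop) : Prop := {
  swo_trans : forall x y z, lt x y -> lt y z -> lt x z;
  swo_total : forall x y, [\/ lt x y, x = y | lt y x];
  swo_min : forall P : set I, P !=set0 ->
    exists2 m, P m & forall x, P x -> ~ lt x m
}.

Lemma strict_well_order_exists (I : choiceType) :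
  exists lt : I -> I -> Prop, strict_well_order lt.
Proof.
have [R wR] := wochoice.well_ordering_principle I.
have minR (P : set I) : P !=set0 -> exists2 m, P m & forall x, P x -> R m x.
  move=> [x Px]; have [|m [[mP lem] _]] := wR [pred x | `[< P x >]].
    by exists x; apply/asboolP.
  exists m; first exact/asboolP.
  by move=> y Py; apply: lem; apply/asboolP.
have anti x y : R x y -> R y x -> x = y.
  move=> xy yx.
  have xx : R x x by have [|m -> /(_ _ erefl)] := minR [set x]; [exists x|].
  have yy : R y y by have [|m -> /(_ _ erefl)] := minR [set y]; [exists y|].
  have [|m [_ mU]] := wR (pred2 x y); first by exists x; rewrite inE eqxx.
  rewrite -(mU x) ?(mU y) //; split; rewrite ?inE ?eqxx ?orbT // => t.
    by rewrite inE => /orP[] /eqP ->.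
  by rewrite inE => /orP[] /eqP ->.
have total x y : R x y \/ R y x.
  have [|m [->|->] mP] := minR [set t | t = x \/ t = y].
  - by exists x; left.
  - by left; apply: mP; right.
  - by right; apply: mP; left.
have trans x y z : R x y -> R y z -> R x z.
  move=> xy yz; have [|m mt mP] := minR [set t | [\/ t = x, t = y | t = z]].
    by exists x; constructor 1.
  have mz : R m z by apply: mP; constructor 3.
  have my : R m y by apply: mP; constructor 2.
  have mx : R m x by apply: mP; constructor 1.
  case: mt => mE; first by rewrite -mE.
    by rewrite (anti x y) // -mE.
  by rewrite -(anti y z) // -mE.
exists (fun x y => R x y /\ x <> y); split.
- move=> x y z [xy nxy] [yz nyz]; split; first exact: trans yz.
  by move=> xz; apply: nxy; apply: anti; rewrite // xz.
- move=> x y; have [->|nxy] := pselect (x = y); first by constructor 2.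
  have [xy|yx] := total x y; first by constructor 1.
  by constructor 3; split=> // /esym.
- move=> P /minR[m Pm mP]; exists m => // x /mP mx [xm nxm].
  by apply: nxm; exact: anti.
Qed.

(** The set [E] is the least initial segment that belongs to [F], or the whole
    index set. *)
Lemma ultra_cofinal {I : Type} {lt : I -> I -> Prop} {F : set_system I} :
  strict_well_order lt -> UltraFilter F -> (forall i, ~ F [set i]) ->
  exists2 E, F E & forall i, E i -> F [set t | E t /\ lt i t].
Proof.
move=> lo UF nF.
have above i : ~ F [set t | lt t i] -> F [set t | lt i t].
  move=> /(ultra_complement UF) Fi.
  have Fn := (ultra_complement UF _).2 (nF i).
  apply: filterS (filterI Fi Fn) => t [ti ni].
  by have [//|/esym|] := swo_total lo i t.
have [small|nsmall] := pselect (exists i, F [set t | lt t i]).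
  have [i Fi mini] := swo_min lo small.
  exists [set t | lt t i] => // t ti.
  by apply: filterI => //; apply: above => /mini.
exists setT; first exact: filterT.
move=> i _; have Fi : F [set t | lt i t].
  by apply: above => Fi; apply: nsmall; exists i.
by apply: filterS Fi => t.
Qed.

Section NestedNeighbourhoods.
Local Open Scope group_scope.
Context {G : topologicalGroupType}.

(** The inverse in this condition gives symmetry and products with a shift of one
    or two indices, and makes the core a closed subgroup. *)
Definition nested (s : nat -> set G) : Prop := forall n,
  nbhs (1 : G) (s n) /\ forall x y, s n.+1 x -> s n.+1 y -> s n (x^-1 * y).

Definition core (s : nat -> set G) : set G := \bigcap_n s n.

Lemma nested_exists (W : set G) : nbhs (1 : G) W ->
  exists2 s, nested s & s 0%N `<=` W.
Proof.
move=> nW; have /choice[half halfP] (B : set G) : exists B' : set G,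
    nbhs (1 : G) B -> nbhs (1 : G) B' /\
      forall x y, B' x -> B' y -> B (x^-1 * y).
  have [/(group_filter_div group_filter_nbhs)[B' ? ?]|] :=
    pselect (nbhs (1 : G) B); first by exists B'.
  by exists set0.
exists (fun n => iter n half W) => //.
have nI n : nbhs (1 : G) (iter n half W).
  by elim: n => //= n /halfP[].
by move=> n; split=> //; exact: (halfP _ (nI n)).2.
Qed.

Lemma nested_shift (s : nat -> set G) (m : nat) :
  nested s -> nested (fun n => s (m + n)%N).
Proof. by move=> ns n; rewrite addnS; exact: ns. Qed.

Context {s : nat -> set G} (ns : nested s).

Lemma nested_one n : s n 1.
Proof. exact: nbhs_singleton (ns n).1. Qed.

Lemma nested_inv n x : s n.+1 x -> s n x^-1.
Proof.
by move=> sx; rewrite -[x^-1]mulg1; apply: (ns n).2 => //; exact: nested_one.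
Qed.

Lemma nested_sub n : s n `<=` s 0%N.
Proof.
elim: n => // n IHn x sx; apply: IHn; rewrite -[x]mul1g -invg1.
by apply: (ns n).2 => //; exact: nested_one.
Qed.

Lemma nested_mul n x y : s n.+2 x -> s n.+1 y -> s n (x * y).
Proof. by move=> /nested_inv sx sy; rewrite -[x]invgK; exact: (ns n).2. Qed.

Lemma core_one : core s 1.
Proof. by move=> n _; exact: nested_one. Qed.

Lemma core_inv x : core s x -> core s x^-1.
Proof. by move=> cx n _; apply: nested_inv; exact: cx. Qed.

Lemma core_mul x y : core s x -> core s y -> core s (x * y).
Proof. by move=> cx cy n _; apply: nested_mul; [exact: cx|exact: cy]. Qed.

Lemma core_closed : closed (core s).
Proof.
move=> x clx n _.
have [|y [cy /= sy]] := clx [set y | s n.+1 (y^-1 * x)].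
  apply/nbhs_translate.
  have := group_filter_inv group_filter_nbhs (ns n.+1).1.
  by apply: filterS => w /=; rewrite invgM mulgVK.
have -> : x = y * (y^-1 * x) by rewrite mulVKg.
by apply: nested_mul => //; exact: cy.
Qed.

End NestedNeighbourhoods.

Section LimitNotNeighbourhood.
Local Open Scope group_scope.
Context {G : topologicalGroupType} {V0 : set G} (cV0 : compact V0).
Context {T : choiceType} {lt : T -> T -> Prop} (lo : strict_well_order lt).
Context {a : T -> nat -> set G} (na : forall i, nested (a i)).
Hypothesis aV0 : forall i, a i 0%N `<=` V0.

Definition earlier_core (i : T) : set G :=
  [set x | forall t, lt t i -> core (a t) x].

Context {z : T -> G} (zQ : forall i, earlier_core i (z i)).
Hypothesis za : forall i, ~ a i 0%N (z i).

Lemma earlier_core_mul i x y :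
  earlier_core i x -> earlier_core i y -> earlier_core i (x * y).
Proof.
by move=> Qx Qy t ti; apply: core_mul => //; [exact: Qx|exact: Qy].
Qed.

Lemma earlier_core_decr i t :
  lt i t -> earlier_core t `<=` earlier_core i `&` core (a i).
Proof.
move=> it x Qx; split; last exact: Qx.
by move=> u ui; apply: Qx; exact: (swo_trans lo) it.
Qed.

Lemma earlier_core_closed i : closed (earlier_core i).
Proof.
move=> x clx t ti; apply: (core_closed (na t)) => B nB.
by have [y [Qy By]] := clx B nB; exists y; split=> //; exact: Qy.
Qed.

(** The factor [z i] moves every coset of [core (a i)] that meets [a i 4] off
    [a i 4], and the factors chosen for larger indices lie in [core (a i)]. *)
Lemma avoid_finitely_many (l : seq T) (b : T) (y : G) :
  (forall i, i \in l -> lt b i) ->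
  exists2 q, (earlier_core b `&` core (a b)) q &
    forall i, i \in l -> ~ a i 4 (y * q).
Proof.
have [n] := ubnP (size l); elim: n l b y => // n IHn l b y /ltnSE ln bl.
have [[m ml mmin]|lmin] :=
    pselect (exists2 m, m \in l & forall i, i \in l -> ~ lt i m); last first.
  exists 1; first by split=> [t _|]; exact: core_one.
  move=> i il; case: lmin; apply: (swo_min lo (P := [set j | j \in l])).
  by exists i.
have [q1 Q1 q1P] : exists2 q1, earlier_core m q1 &
    forall p, core (a m) p -> ~ a m 4 (y * q1 * p).
  have [[p cp yp]|avoid] :=
      pselect (exists2 p, core (a m) p & a m 4 (y * p)); last first.
    exists 1; first by move=> t _; exact: core_one.
    by rewrite mulg1 => p cp yp; apply: avoid; exists p.
  exists (z m) => // p' cp' yzp'; apply: (@za m).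
  have := (na m 3).2 _ _ yp yzp'.
  have -> : (y * p)^-1 * (y * z m * p') = p^-1 * z m * p'.
    by rewrite invgM !mulgA mulgVK.
  move=> u3; rewrite -[z m](mulgK p').
  apply: (nested_mul (na m) (n := 0)); last exact: core_inv.
  rewrite -[_ * p'](mulVKg p); apply: (nested_mul (na m) (n := 2)).
    exact: cp.
  by rewrite mulgA.
have [||q2 [Q2 c2] q2P] := IHn [seq i <- l | i != m] m (y * q1).
- apply: leq_trans ln; rewrite size_filter -(count_predC (pred1 m) l).
  by rewrite -[X in (X < _)%N]add0n ltn_add2r -has_count has_pred1.
- move=> i; rewrite mem_filter => /andP[/eqP im il].
  by have [/(mmin i il)|/im|] := swo_total lo i m.
exists (q1 * q2).
  apply: (@earlier_core_decr b m); first exact: bl.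
  exact: earlier_core_mul.
move=> i il; rewrite mulgA; have [->|im] := eqVneq i m; first exact: q1P.
by apply: q2P; rewrite mem_filter im.
Qed.

(** Here [NE] is the intersection of the cores indexed by [E].  If [V] were a
    neighbourhood, [earlier_core i0] would be contained in [NE * V] for some [i0],
    because these compact sets decrease to [NE].  A cluster point of the elements
    that avoid finitely many [a i 4] contradicts this.  Each product or inverse
    costs at most two indices, whence the levels [4] to [7]. *)
Lemma limit_not_nbhs (F : set_system T) :
  UltraFilter F -> (forall i, ~ F [set i]) ->
  ~ nbhs (1 : G) [set x | F [set i | a i 7 x]].
Proof.
move=> UF nF; set V := [set x | _] => nV.
have [E FE Ecof] := ultra_cofinal lo UF nF.
have later i : E i -> exists2 t, E t & lt i t.
  by move=> /Ecof/filter_ex[t []]; exists t.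
have sub_V0 i t : lt i t -> earlier_core t `<=` V0.
  by move=> /earlier_core_decr it x /it[_ /(_ 0%N I)]; exact: aV0.
pose NE : set G := [set x | forall i, E i -> core (a i) x].
have [i0 Ei0 Qi0] : exists2 i0, E i0 & forall x, earlier_core i0 x ->
    exists n v, [/\ NE n, V v & x = n * v].
  apply: contrapT => noi0.
  pose B i := [set x | earlier_core i x /\
    ~ exists n v, [/\ NE n, V v & x = n * v]].
  have PB : ProperFilter (filter_from E B).
    apply: filter_from_proper.
      apply: filter_from_filter; first exact: filter_ex FE.
      move=> i j Ei Ej; have [ij|<-|ji] := swo_total lo i j.
      - exists j => // x [Qx nx]; split; split=> //.
        by have [] := earlier_core_decr ij Qx.
      - by exists i.
      - exists i => // x [Qx nx]; split; split=> //.
        by have [] := earlier_core_decr ji Qx.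
    move=> i Ei; apply: contrapT => nBi; apply: noi0; exists i => // x Qx.
    by apply: contrapT => nx; apply: nBi; exists x.
  have [i Ei] := filter_ex FE; have [t Et it] := later i Ei.
  have [|x [_ clx]] := cV0 PB.
    by exists t => // x [/(sub_V0 _ _ it)].
  (* A cluster point of the sets [B i] belongs to [NE], and its neighbourhood
     [x * V] meets [B i], which is disjoint from [NE * V]. *)
  have NEx : NE x.
    move=> j Ej; have [k Ek jk] := later j Ej.
    suff /(earlier_core_decr jk)[] : earlier_core k x by [].
    apply: earlier_core_closed => C nC.
    by have [|y [[Qy _] Cy]] := clx (B k) C _ nC; [exists k|exists y].
  have [||y [[_ ny] /= Vy]] := clx (B i) [set y | V (x^-1 * y)].
  - by exists i.
  - apply/nbhs_translate; apply: filterS nV => w /=.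
    by rewrite mulKg.
  by apply: ny; exists x, (x^-1 * y); rewrite mulVKg.
pose S := [set l : seq T | forall i, i \in l -> E i /\ lt i0 i].
pose B (l : seq T) := [set q | (earlier_core i0 `&` core (a i0)) q /\
  forall i, i \in l -> ~ a i 4 q].
have PB : ProperFilter (filter_from S B).
  apply: filter_from_proper.
    apply: filter_from_filter; first by exists [::].
    move=> l l' Sl Sl'; exists (l ++ l').
      by move=> i; rewrite mem_cat => /orP[/Sl|/Sl'].
    move=> x [Qx lx]; split; split=> // i il; apply: lx; rewrite mem_cat il //.
    by rewrite orbT.
  move=> l Sl; have [|q Qq ql] := @avoid_finitely_many l i0 1.
    by move=> i /Sl[].
  by exists q; split=> // i /ql; rewrite mul1g.
have [|x [_ clx]] := cV0 PB.
  by exists [::] => // x [[_ /(_ 0%N I) ax] _]; exact: aV0 ax.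
have [n [v [NEn Vv xE]]] : exists n v, [/\ NE n, V v & x = n * v].
  apply: Qi0; apply: earlier_core_closed => C nC.
  have [|y [[[Qy _] _] Cy]] := clx (B [::]) C _ nC; first by exists [::].
  by exists y.
have [i /= [[Ei i0i] av]] := filter_ex (filterI (Ecof _ Ei0) Vv).
have ax : a i 6 x.
  rewrite xE -[n]invgK; apply: (na i 6).2 => //.
  by apply: core_inv => //; exact: NEn.
have [||y [[_ ny] /= ay]] := clx (B [:: i]) [set y | a i 5 (x^-1 * y)].
- by exists [:: i] => // j; rewrite inE => /eqP ->.
- apply/nbhs_translate; apply: filterS (na i 5).1 => w /=.
  by rewrite mulKg.
apply: (ny i); first exact: mem_head.
rewrite -[y](mulVKg x); apply: nested_mul => //.
Qed.

End LimitNotNeighbourhood.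

Lemma strict_well_order_sub (T : choiceType) (lt : T -> T -> Prop) (D : set T) :
  strict_well_order lt ->
  strict_well_order (fun x y : set_type D => lt (val x) (val y)).
Proof.
move=> lo; split.
- by move=> x y z; exact: (swo_trans lo).
- move=> x y; have [xy|/val_inj xy|yx] := swo_total lo (val x) (val y).
  + by constructor 1.
  + by constructor 2.
  + by constructor 3.
- move=> P [x Px]; have [|_ [m Pm <-] mP] := swo_min lo (P := val @` P).
    by exists (val x), x.
  by exists m => // y Py; apply: mP; exists y.
Qed.

Section Strictness.
Local Open Scope group_scope.
Context {G : topologicalGroupType} {V0 : set G}.
Hypotheses (nV0 : nbhs (1 : G) V0) (cV0 : compact V0).
Context {lt : (nat -> set G) -> (nat -> set G) -> Prop}.
Hypothesis lo : strict_well_order lt.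

Definition nested_in : set (nat -> set G) :=
  [set s | nested s /\ s 0%N `<=` V0].

(** The nested sequences whose core cuts down the intersection of the earlier
    cores. *)
Definition strict_drop : set (nat -> set G) :=
  [set s | nested_in s /\ exists x,
    (forall t, nested_in t -> lt t s -> core t x) /\ ~ core s x].

(** If [x] lay outside some core, then the first such core would be a strict
    drop. *)
Lemma strict_drop_separates x :
  (forall s, strict_drop s -> core s x) -> x = 1.
Proof.
move=> Dx; have Jx s : nested_in s -> core s x.
  move=> Js; apply: contrapT => nsx.
  have [|t [Jt ntx] tmin] :=
    swo_min lo (P := [set t | nested_in t /\ ~ core t x]); first by exists s.
  apply: (ntx); apply: Dx; split=> //; exists x; split=> // u Ju ut.
  by apply: contrapT => nux; exact: (tmin u (conj Ju nux) ut).
apply: (group_filter_sep group_filter_nbhs) => W nW.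
have [s ns sWV] := nested_exists (filterI nW nV0).
have Js : nested_in s by split=> // y /sWV[].
by have /sWV[] := Jx s Js 0%N I.
Qed.

(** Colouring [V0] by the members of finite covers by translates of the [s n]
    encodes a point of [V0] by a subset of [strict_drop * nat * nat]. *)
Lemma strict_drop_Ulam : Ulam_type V0 -> Ulam_type strict_drop.
Proof.
move=> UV0; apply: (@Ulam_type_prod _ nat not_Ulam_nat).
apply: (@Ulam_type_prod _ nat not_Ulam_nat); apply: Ulam_type_powerset.
have /choice[col colP] (sn : strict_drop * nat) : exists c : G -> nat,
    forall x y, V0 x -> V0 y -> c x = c y -> val sn.1 sn.2 (x^-1 * y).
  have [[ns _] _] := set_mem (valP sn.1).
  have [_ [c [_ cP]]] := compact_totally_bounded cV0 (ns sn.2).1.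
  by exists c.
apply: (@Ulam_type_inj _ _ (fun x : V0 => [set p | col p.1 (val x) = p.2])) UV0.
move=> x y /= xy; apply: val_inj.
suff xy1 : (val x)^-1 * val y = 1.
  by rewrite -[RHS](mulVKg (val x)) xy1 mulg1.
apply: strict_drop_separates => s Ds n _.
apply: (colP (SigSub (mem_set Ds), n)); [exact: set_mem (valP x)| |].
  exact: set_mem (valP y).
pose sn := (SigSub (mem_set Ds) : set_type strict_drop, n).
have : [set p | col p.1 (val x) = p.2] (sn, col sn (val x)) by [].
by rewrite xy.
Qed.

End Strictness.

Lemma ultra_nbhs_strict (G : topologicalGroupType) (V : set G) :
  nbhs (1%g : G) V -> compact V -> Ulam_type V ->
  exists (T : Type) (F : set_system T), [/\ UltraFilter F, omega1_complete F &
    exists2 B, @ultra_nbhs G (nbhs (1%g : G)) T F B & ~ nbhs (1%g : G) B].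
Proof.
move=> nV cV UV.
have [lt lo] := strict_well_order_exists ((nat -> set G) : choiceType).
have [F [UF oF npF]] := strict_drop_Ulam nV cV lo UV.
pose D := set_type (@strict_drop G V lt).
have /choice[z zP] (s : D) : exists x,
    (forall t, nested_in (V0 := V) t -> lt t (val s) -> core t x) /\
    ~ core (val s) x.
  by have [] := set_mem (valP s).
have /choice[m mP] (s : D) : exists m, ~ val s m (z s).
  by have [_ /existsNP[m /not_implyP[_ ?]]] := zP s; exists m.
(* Starting [s] at the index [m s] makes its first member avoid [z s]. *)
pose a (s : D) n := val s (m s + n)%N.
have Ds (s : D) : nested_in (V0 := V) (val s).
  by have [] := set_mem (valP s).
have na (s : D) : nested (a s) by exact: nested_shift (Ds s).1.
exists D, F; split=> //.
exists [set x | F [set s | a s 7 x]].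
  by apply: ultra_nbhs_family => s; exact: (na s 7).1.
apply: (limit_not_nbhs cV (strict_well_order_sub _ lo) na _ _ _ UF).
- by move=> s x; rewrite /a => /(nested_sub (Ds s).1); exact: (Ds s).2.
- move=> s t ts n _; rewrite /a; exact: (zP s).1 (Ds t) ts _ _.
- by move=> s; rewrite /a addn0; exact: mP.
- by move=> s /(ultra_principal UF); exact: npF.
Qed.

(** * The two topologies on the group *)

Lemma agree_onP (T : Type) (S : set T) (tau1 tau2 : Topological T) :
  (forall B : set T, @open (Topological.Pack tau1) B ->
    exists2 B' : set T, @open (Topological.Pack tau2) B' & S `&` B = S `&` B') ->
  (forall B : set T, @open (Topological.Pack tau2) B ->
    exists2 B' : set T, @open (Topological.Pack tau1) B' & S `&` B = S `&` B') ->
  agree_on S tau1 tau2.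
Proof.
have sub (s1 s2 : Topological T) :
    (forall B : set T, @open (Topological.Pack s1) B -> exists2 B' : set T,
      @open (Topological.Pack s2) B' & S `&` B = S `&` B') ->
    @open (set_type (S : set (Topological.Pack s1))) `<=`
    @open (set_type (S : set (Topological.Pack s2))).
  move=> s12 _ [B /s12[B' oB' BB'] <-]; exists B' => //.
  apply/seteqP; split=> x /= Bx.
    have [] // : (S `&` B) (set_val x).
    by rewrite BB'; split=> //; exact: set_valP.
  have [] // : (S `&` B') (set_val x).
  by rewrite -BB'; split=> //; exact: set_valP.
move=> s12 s21; apply/seteqP; split; [exact: (sub _ _ s12)|exact: (sub _ _ s21)].
Qed.

Section UltrapowerGroupTopology.
Local Open Scope group_scope.
Context {G : topologicalGroupType} {I : Type} {F : set_system I}.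
Context (UF : UltraFilter F) (oF : omega1_complete F).
Let N : set_system G := nbhs (1 : G).
Let NU : set_system G := @ultra_nbhs G N I F.
Let NUF : group_filter NU :=
  group_filter_ultra_nbhs ultra_proper group_filter_nbhs.
Let tau : Topological G := Topological.class (group_of_filter NUF).

Lemma ultra_open (B : set G) :
  @open (Topological.Pack tau) B <-> forall x, B x -> NU [set w | B (x * w)].
Proof. by rewrite openE. Qed.

Lemma ultra_open_finer (B : set G) :
  open B -> @open (Topological.Pack tau) B.
Proof.
rewrite openE => oB; apply/ultra_open => x /oB /nbhs_translate.
exact: ultra_nbhs_finer.
Qed.

Lemma ultra_agree_on (S : set G) : ~ Ulam_measurable S ->
  agree_on S tau (Topological.class G).
Proof.
move=> nS; apply: agree_onP => B; last by exists B => //; exact: ultra_open_finer.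
move=> /ultra_open oB.
exists (\bigcup_(C in [set C : set G | open C /\ S `&` C `<=` B]) C).
  by apply: bigcup_open => C [].
apply/seteqP; split=> x [Sx]; last first.
  by move=> [C [_ CB] Cx]; split=> //; exact: CB.
move=> Bx; split=> //; have [W NW WB] := oB x Bx.
have [V NV VP] := ultra_nbhs_trace UF oF x nS NW.
have nxV : nbhs x [set y | V (x^-1 * y)].
  by apply/nbhs_translate; apply: filterS NV => w /=; rewrite mulKg.
exists (interior [set y | V (x^-1 * y)]) => //; split; first exact: open_interior.
move=> y [Sy /interior_subset Vy].
by rewrite -[y](mulVKg x); apply: WB; exact: VP.
Qed.

Lemma ultra_strictly_finer (B : set G) :
  NU B -> ~ N B -> strictly_finer tau (Topological.class G).
Proof.
move=> NUB nNB; split; first exact: ultra_open_finer.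
move=> fin; apply: nNB.
have nB : @nbhs _ (group_of_filter NUF) 1 B by rewrite group_of_filter_nbhs1.
have oB := fin _ (@open_interior (group_of_filter NUF) B).
have : nbhs (1 : G) (@interior (group_of_filter NUF) B).
  by move: oB; rewrite openE; apply.
by apply: filterS => x /(@interior_subset (group_of_filter NUF)).
Qed.

End UltrapowerGroupTopology.

Lemma morphism_sequentially_continuous (G H : topologicalGroupType)
    (f : {multiplicative G -> H}) :
  (forall (u : nat -> G) (B : set H), nbhs (1%g : H) B ->
    u @ \oo --> (1%g : G) -> \forall n \near \oo, B (f (u n))) ->
  sequentially_continuous f.
Proof.
move=> f1 u x ux B /nbhs_translate nB.
have u1 : (fun n => x^-1 * u n)%g @ \oo --> (1%g : G).
  rewrite -[X in _ --> X](mulVg x).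
  by apply: continuous_cvg ux; exact: mulg_continuousl.
have := f1 _ _ nB u1; apply: filterS => n /=.
by rewrite -gmulfM mulVKg.
Qed.

Theorem theorem3p16 (G : topologicalGroupType)
    (lcG : locally_compact [set: G])
    (T : Type) (kappa : set T)
    (lwG : is_local_weight G kappa)
    (Ukappa : Ulam_measurable kappa) :
  (exists tau : Topological G,
      [/\ group_topology tau,
          strictly_finer tau (Topological.class G) &
          forall S : set G, ~ Ulam_measurable S ->
            agree_on S tau (Topological.class G)]) /\
  (exists (H : topologicalGroupType) (f : {multiplicative G -> H}),
      [/\ locally_compact [set: H],
          sequentially_continuous f &
          ~ continuous f]).
Proof.
have [V nV [cV _]] := lcG (1%g : G) I.
have {}nV : nbhs (1%g : G) V.
  by move: nV; rewrite /within /=; apply: filterS => x; exact.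
have [J [F [UF oF [B UB nB]]]] :=
  ultra_nbhs_strict nV cV (Ulam_type_nbhs lwG Ukappa nV).
split.
  exists (Topological.class (group_of_filter
    (group_filter_ultra_nbhs (@ultra_proper _ _ UF) (@group_filter_nbhs G)))).
  split; first exact: group_of_filter_topology.
    exact: ultra_strictly_finer UB nB.
  exact: ultra_agree_on.
have [H [f [lcH fN Nf]]] := locally_compact_completion
  (group_filter_ultra_nbhs (@ultra_proper _ _ UF) (@group_filter_nbhs G))
  (ultra_nbhs_finer ultra_proper nV)
  (totally_bounded_ultra_nbhs UF oF (compact_totally_bounded cV)).
exists H, f; split=> // [|cf].
  apply: morphism_sequentially_continuous => u C nC u1.
  by apply: (ultra_nbhs_sequence UF oF) (fN _ nC) => W nW; exact: u1.
have [C nC CB] := Nf _ UB; apply: nB; apply: filterS CB _.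
have f1 : f 1%g = 1%g by apply: (mulgI (f 1%g)); rewrite -gmulfM !mulg1.
by apply: (cf 1%g); rewrite f1.
Qed.
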